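(* Let $n\in\mathbb{N}$, $\tau\in\mathbb{C}\setminus\{0\}$, $\gamma\in[0,1)$, and suppose $Q$ is a polynomial of degree $\le n$. Then (i) $P*_{GS}Q\in\pi_{n}(\Omega_{\tau,\gamma})$ for all $P\in\pi_{n}(\overline{\Omega}_{\tau,\gamma})$ if, and only if, $Q\in\pi_{n}(I_{\gamma})$, (ii) $P*_{GS}Q\in\pi_{n}(\Omega_{\tau,\gamma})$ for all $P\in\pi_{n}(\Omega_{\tau,\gamma})$ if, and only if, $Q\in\pi_{n}(\overline{I}_{\gamma})$, (iii) $P*_{GS}Q\in\pi_{\leq n}(\mathbb{C}\setminus\overline{\Omega}_{\tau,\gamma})$ for all $P\in\pi_{\leq n}(\mathbb{C}\setminus\Omega_{\tau,\gamma})$ if, and only if, $Q\in\pi_{\leq n}(O_{\gamma})$, (iv) $P*_{GS}Q\in\pi_{\leq n}(\mathbb{C}\setminus\overline{\Omega}_{\tau,\gamma})$ for all $P\in\pi_{\leq n}(\mathbb{C}\setminus\overline{\Omega}_{\tau,\gamma})$ if, and only if, $Q\in\pi_{\leq n}(\overline{O}_{\gamma})$, (v) $P*_{GS}Q\in\pi_{n}(I_{\gamma})$ for all $P\in\pi_{n}(\overline{I}_{\gamma})$ if, and only if, $Q\in\pi_{n}(I_{\gamma})$, and (vi) $P*_{GS}Q\in\pi_{\leq n}(O_{\gamma})$ for all $P\in\pi_{\leq n}(\overline{O}_{\gamma})$ if, and only if, $Q\in\pi_{\leq n}(O_{\gamma})$.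
   Context: All polynomials have complex coefficients. For $\Omega\subseteq\mathbb{C}$, $\pi_{n}(\Omega)$ and $\pi_{\leq n}(\Omega)$ denote the sets of polynomials of degree $n$ and of degree $\le n$, respectively, all of whose zeros lie in $\Omega$ (nonzero constants have no zeros and belong to $\pi_{\le n}(\Omega)$; the zero polynomial does not). For $F(z)=\sum_{k=0}^{n}\binom{n}{k}a_{k}z^{k}$ and $G(z)=\sum_{k=0}^{n}\binom{n}{k}b_{k}z^{k}$ the Grace-Szegő convolution is $F*_{GS}G(z)=\sum_{k=0}^{n}\binom{n}{k}a_{k}b_{k}z^{k}$. $\mathbb{D}$ is the open unit disk. For $\tau\in\mathbb{C}\setminus\{0\}$ and $\gamma\in[0,1)$, $\Omega_{\tau,\gamma}=w_{\tau,\gamma}(\mathbb{D})$, where $w_{\tau,\gamma}(z)=\frac{\tau z}{1+\gamma z}$ (an open disk containing the origin). Further $$I_{\gamma}=\{z\in\mathbb{C}:|z|+\gamma|1+z|<1\},\qquad O_{\gamma}=\{z\in\mathbb{C}:|z|-\gamma|1+z|>1\}.$$ $\overline{\Omega}_{\tau,\gamma}$, $\overline{I}_{\gamma}$, $\overline{O}_{\gamma}$ denote the closures of these sets in $\mathbb{C}$. *)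

(* Defs.v *)
From mathcomp Require Export all_boot all_order all_algebra.
From mathcomp Require Export complex.
From mathcomp Require Export all_classical all_reals all_analysis.

Set Implicit Arguments.
Unset Strict Implicit.
Unset Printing Implicit Defensive.

Export Order.TTheory GRing.Theory Num.Theory.
Export numFieldNormedType.Exports.
Open Scope classical_set_scope.
Open Scope ring_scope.
Open Scope complex_scope.

(* The definitions are over a generic numFieldType C, to be instantiated with
   R[i], because this is the form in which the norm topology used by [closure]
   is inferred. *)

Definition pi_eq (C : numFieldType) (n : nat) (A : set C) : set {poly C} :=
  [set P : {poly C} | size P = n.+1 /\ forall z, root P z -> A z].

Definition pi_le (C : numFieldType) (n : nat) (A : set C) : set {poly C} :=
  [set P : {poly C} | [/\ P != 0, (size P <= n.+1)%N & forall z, root P z -> A z]].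

(* If F = \sum_k 'C(n, k) a_k X^k and G = \sum_k 'C(n, k) b_k X^k then
   F`_k * G`_k / 'C(n, k) = 'C(n, k) a_k b_k; see GSconvE. *)
Definition GSconv (C : numFieldType) (n : nat) (F G : {poly C}) : {poly C} :=
  \poly_(k < n.+1) (F`_k * G`_k / 'C(n, k)%:R).

Lemma GSconvE (C : numFieldType) (n : nat) (a b : nat -> C) :
  GSconv n (\poly_(k < n.+1) ('C(n, k)%:R * a k))
           (\poly_(k < n.+1) ('C(n, k)%:R * b k)) =
  \poly_(k < n.+1) ('C(n, k)%:R * a k * b k).
Proof.
apply/polyP => k; rewrite !coef_poly; case: ifP => // lekn; rewrite lekn.
have binN0 : ('C(n, k)%:R : C) != 0 by rewrite pnatr_eq0 -lt0n bin_gt0.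
by rewrite -mulrA [X in _ * X = _]mulrAC divff // mul1r.
Qed.

Definition unit_disk (C : numFieldType) : set C := [set z | `|z| < 1].

Definition w (C : numFieldType) (tau gamma z : C) : C :=
  tau * z / (1 + gamma * z).

Definition Omega (C : numFieldType) (tau gamma : C) : set C :=
  w tau gamma @` @unit_disk C.

Definition Iset (C : numFieldType) (gamma : C) : set C :=
  [set z | `|z| + gamma * `|1 + z| < 1].

Definition Oset (C : numFieldType) (gamma : C) : set C :=
  [set z | `|z| - gamma * `|1 + z| > 1].

(* Main.v *)
Require Import Defs.
From HB Require Import structures.
From mathcomp Require Import ring.

(** The theorem rests on Grace's theorem for disks. For fixed Q and z, the value
    at z of the convolution of P and Q is linear in P; hence if it vanishes for
    a product P of n factors 'X - u_j with all u_j in a disk, then it vanishes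
    for some power ('X - u)^n with u in that disk ([Grace]). The convolution of
    this power with Q is essentially Q (- z / u), so that z = - u v with u in the
    disk and v a zero of Q ([Szego]). When P has degree at most n and its zeros
    are outside a disk containing 0, the same argument applies to the
    reciprocals y of the zeros, which fill another disk Y, a zero at infinity
    giving y = 0; a zero z of the convolution then satisfies Q (- y z) = 0 for
    some y in Y ([Szego_reversed]).

    It remains to decide for which v all products - u v, with u in the disk Om,
    stay in Om, and similarly for quotients. In terms of the preimage of u in
    the unit disk, u is in Om if and only if |u| < |tau - g u|, and

      |tau + g u v| >= |tau - g u| - g |u| |1 + v|

    shows that the condition |v| + g |1 + v| < 1 (or <= 1) suffices. It is
    necessary because the argument of u can be chosen to make this triangle
    inequality an equality ([extremal_factor_I]). The region O comes in the same
    way from y (tau - g z) = (tau y - g) + g (1 - y z) ([extremal_factor_O]).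
    Testing the multiplier property on the n-th powers of linear polynomials
    turns these facts on points into the first four equivalences. In the last
    two, I and O are the multiplier regions just found, and associativity of the
    convolution applies, its unit (1 + 'X)^n being itself an admissible factor.

    Grace's theorem follows from Laguerre's theorem on n f + (a - u) f', which
    holds because the numbers (a - p) / (u - p), for p outside a disk containing
    the distinct points a and u, lie in an open half-plane that has 0 on its boundary. This
    separation property ([polar_separated]) is all that is used of the disk;
    open and closed disks both have it. *)

Set Implicit Arguments.
Unset Strict Implicit.
Unset Printing Implicit Defensive.

(* Outside this scope the star denotes the conjugation of a numClosedFieldType. *)
Local Close Scope complex_scope.

(** * Laguerre's theorem and Grace's theorem *)

Section Laguerre.
Variable C : numClosedFieldType.
Implicit Types (D : set C) (a u p K : C) (f : {poly C}).

(** What the averaging argument of Laguerre needs of a region D, kept apart from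
the geometry so that open and closed disks are treated at once: the map
p |-> (a - p) / (u - p) sends the complement of D into an open half-plane
bounded by a line through 0. The half-plane also contains, up to its boundary,
the value 1 taken at p = infinity, whence the condition on K itself. *)
Definition polar_separated D :=
  forall a u, D a -> D u -> a != u ->
  exists2 K, 0 <= 'Re K & forall p, ~ D p -> 0 < 'Re (K * ((a - p) / (u - p))).

(** With s = r^2 the right-hand side is visibly positive when A and U are in the
disk of radius r about 0 and P is outside it: K = r^2 - A^* U separates. *)
Lemma disk_polar_identity (s A U P : C) : s \is Num.real ->
  'Re ((s - A^* * U) * ((A - P) * (U - P)^*)) *+ 2 =
  (s - `|U| ^+ 2) * `|A - P| ^+ 2 + (s - `|A| ^+ 2) * `|U - P| ^+ 2
  + (`|P| ^+ 2 - s) * `|U - A| ^+ 2.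
Proof.
move=> /conj_Creal s_real; rewrite ReE !normCK -mulr_natr divfK ?pnatr_eq0 //.
rewrite !(rmorphM, rmorphB) /= !conjCK s_real; ring.
Qed.

(** The limit of disk_polar_identity, divided by |P|^2, as P goes to infinity. *)
Lemma disk_polar_identity_infinity (s A U : C) : s \is Num.real ->
  'Re (s - A^* * U) *+ 2 = (s - `|U| ^+ 2) + (s - `|A| ^+ 2) + `|U - A| ^+ 2.
Proof.
move=> /conj_Creal s_real; rewrite ReE !normCK -mulr_natr divfK ?pnatr_eq0 //.
rewrite !(rmorphM, rmorphB) /= !conjCK s_real; ring.
Qed.

(** The map p |-> (a - p) / (u - p) does not change under an affine substitution,
so disks given by an affine inequality need not be put in normal form. *)
Lemma affine_disk_polar_separated D (al be r : C) :
  al != 0 -> 0 <= r ->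
  D = [set u | `|al * u + be| < r] \/ D = [set u | `|al * u + be| <= r] ->
  polar_separated D.
Proof.
move=> al0 r0 defD a u Da Du neq_au.
pose A := al * a + be; pose U := al * u + be.
have affB x y : al * x + be - (al * y + be) = al * (x - y) by ring.
have r2_real : r ^+ 2 \is Num.real by rewrite realX // ger0_real.
have [A_le U_le] : `|A| <= r /\ `|U| <= r.
  by case: defD => E; move: Da Du; rewrite E /= => // /ltW ? /ltW ?.
have subC_ge0 (x : C) : `|x| <= r -> 0 <= r ^+ 2 - `|x| ^+ 2.
  by move=> x_le; rewrite subr_ge0 lerXn2r // nnegrE.
have neq_AU : 0 < `|U - A| ^+ 2.
  by rewrite exprn_gt0 // normr_gt0 affB mulf_neq0 // subr_eq0 eq_sym.
exists (r ^+ 2 - A^* * U).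
  rewrite -(pmulrn_lge0 _ (isT : 0 < 2)%N) disk_polar_identity_infinity //.
  by apply: addr_ge0 (ltW neq_AU); apply: addr_ge0; apply: subC_ge0.
move=> p Dp; pose P := al * p + be.
have P_ge : r <= `|P|.
  case: defD => E; move: Dp; rewrite E /= => /negP.
    by rewrite -real_leNgt ?normr_real ?ger0_real.
  by rewrite -real_ltNge ?normr_real ?ger0_real // => /ltW.
have uP : U - P != 0.
  rewrite affB mulf_neq0 // subr_eq0.
  by apply: contra_notN Dp => /eqP <-.
have aP : A - P != 0.
  rewrite affB mulf_neq0 // subr_eq0.
  by apply: contra_notN Dp => /eqP <-.
have -> : (a - p) / (u - p) = (A - P) * (U - P)^* / `|U - P| ^+ 2.
  have u_p : u - p != 0.
    by move: uP; rewrite affB mulf_eq0 negb_or => /andP[].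
  rewrite normCK -mulf_div divff ?mulr1 ?conjC_eq0 //.
  by rewrite !affB -mulf_div divff // mul1r.
rewrite mulrA ReMr; last by rewrite rpredV rpredX // normr_real.
rewrite pmulr_lgt0 ?invr_gt0 ?exprn_gt0 ?normr_gt0 //.
rewrite -(pmulrn_lgt0 _ (isT : 0 < 2)%N) disk_polar_identity //.
case: defD => E; move: Da Du Dp; rewrite E /= -/A -/U -/P => A_lt U_lt P_gt.
  have ? : 0 < r ^+ 2 - `|U| ^+ 2 by rewrite subr_gt0 ltrXn2r // nnegrE.
  rewrite -addrA ltr_wpDr //; last by rewrite mulr_gt0 // exprn_gt0 // normr_gt0.
  apply: addr_ge0; first by rewrite mulr_ge0 ?subC_ge0 ?exprn_ge0.
  rewrite mulr_ge0 ?exprn_ge0 //.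
  by rewrite subr_ge0 lerXn2r // nnegrE.
rewrite ltr_wpDl //; first by apply: addr_ge0; rewrite mulr_ge0 ?subC_ge0 ?exprn_ge0.
rewrite mulr_gt0 // subr_gt0 ltrXn2r // ?nnegrE //.
by rewrite real_ltNge ?normr_real ?ger0_real //; apply/negP.
Qed.

Lemma log_deriv_prod_XsubC (rs : seq C) u :
  all (fun z => u != z) rs ->
  (\prod_(z <- rs) ('X - z%:P))^`().[u] =
  (\prod_(z <- rs) ('X - z%:P)).[u] * \sum_(z <- rs) (u - z)^-1.
Proof.
elim: rs => [|z rs IH] /=; first by rewrite !big_nil derivC horner0 mulr0.
case/andP=> uz /IH E; rewrite !big_cons derivM derivXsubC mul1r hornerD !hornerM E.
by rewrite hornerXsubC; field; rewrite subr_eq0.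
Qed.

(** Dividing by f(u), the expression becomes the sum of (a - p) / (u - p) over the
zeros p of f, plus one term 1 for each zero of f at infinity (the degree of f
may be less than n + 1). The former lie in the open half-plane given by
polar_separated, the latter in its closure. *)
Lemma Laguerre D n f a u : polar_separated D ->
  (size f <= n.+2)%N -> (forall x, D x -> f.[x] != 0) -> D a -> D u ->
  n.+1%:R * f.[u] + (a - u) * f^`().[u] != 0.
Proof.
move=> sepD szf f0 Da Du.
have [->|neq_au] := eqVneq a u.
  by rewrite subrr mul0r addr0 mulf_neq0 ?pnatr_eq0 ?f0.
have [K K0 Kp] := sepD a u Da Du neq_au.
have [rs def_f] := closed_field_poly_normal f.
have lf0 : lead_coef f != 0.
  by rewrite lead_coef_eq0; apply: contraNneq (f0 u Du) => ->; rewrite horner0.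
have rsD z : z \in rs -> ~ D z.
  move=> z_rs /f0 /negP; apply; rewrite def_f hornerZ mulf_eq0 (negPf lf0) /=.
  by rewrite -/(root _ z) root_prod_XsubC.
have u_rs : all (fun z => u != z) rs.
  by apply/allP => z /rsD; apply: contra_notN => /eqP <-.
have sz_rs : (size rs <= n.+1)%N.
  by move: szf; rewrite def_f size_scale // size_prod_XsubC.
have -> : n.+1%:R * f.[u] + (a - u) * f^`().[u] =
    f.[u] * ((n.+1 - size rs)%:R + \sum_(z <- rs) (a - z) / (u - z)).
  have -> : \sum_(z <- rs) (a - z) / (u - z) =
      \sum_(z <- rs) (1 + (a - u) * (u - z)^-1).
    rewrite big_seq [RHS]big_seq; apply: eq_bigr => z /(allP u_rs) uz.
    by field; rewrite subr_eq0.
  rewrite big_split /= big_const_seq count_predT iter_addr_0 -mulr_sumr.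
  rewrite addrA -natrD subnK // [in f^`()]def_f derivZ hornerZ.
  have fE : f.[u] = lead_coef f * (\prod_(z <- rs) ('X - z%:P)).[u].
    by rewrite -hornerZ -def_f.
  by rewrite log_deriv_prod_XsubC // fE; ring.
apply: mulf_neq0; first exact: f0.
(* Zeros at infinity contribute only a weak inequality: one finite zero is needed. *)
have [rs0|rs0] := posnP (size rs).
  by rewrite (size0nil rs0) big_nil addr0 subn0 pnatr_eq0.
suff: 0 < 'Re (K * ((n.+1 - size rs)%:R + \sum_(z <- rs) (a - z) / (u - z))).
  by apply: contraTneq => ->; rewrite mulr0 raddf0 ltxx.
rewrite mulrDr raddfD /= ltr_wpDl //.
  by rewrite ReMr ?realn // mulr_ge0.
rewrite mulr_sumr raddf_sum /=.
case: rs rs0 rsD {def_f u_rs sz_rs} => // z rs _ rsD; rewrite big_cons ltr_wpDr //.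
  rewrite big_seq sumr_ge0 // => x xrs; rewrite ltW // Kp //.
  by apply: rsD; rewrite inE xrs orbT.
by apply: Kp; apply: rsD; rewrite inE eqxx.
Qed.

(** L ((x - u y)^m) is a polynomial in u, to which Laguerre's theorem applies,
and its derivative is obtained by differentiating inside L. *)
Lemma scalar_power_poly (L : {scalar {poly C}}) (x y : {poly C}) m :
  exists2 f : {poly C}, (size f <= m.+1)%N &
    (forall u, f.[u] = L ((x - u *: y) ^+ m)) /\
    (forall u, f^`().[u] = - (m%:R * L (y * (x - u *: y) ^+ m.-1))).
Proof.
exists (\poly_(i < m.+1) ((-1) ^+ i * 'C(m, i)%:R * L (x ^+ (m - i) * y ^+ i))).
  exact: size_poly.
split=> u.
  rewrite horner_poly exprDn raddf_sum /=; apply: eq_bigr => i _.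
  rewrite raddfMn /= -scaleNr exprZn -scalerAr scalarZ -mulr_natr [in RHS]exprNn; ring.
case: m => [|m] /=.
  rewrite mul0r oppr0 poly_def big_ord_recl big_ord0 addr0 expr0 alg_polyC.
  by rewrite derivC horner0.
set f := \poly_(i < m.+2) _.
have -> : f^`() = \poly_(i < m.+1)
    ((-1) ^+ i.+1 * 'C(m.+1, i.+1)%:R *+ i.+1 * L (x ^+ (m - i) * y ^+ i.+1)).
  apply/polyP => i; rewrite coef_deriv !coef_poly ltnS.
  by case: ifP => _; [rewrite subSS !mulrnAl | rewrite mul0rn].
rewrite horner_poly exprDn mulr_sumr raddf_sum /= mulr_sumr -sumrN.
apply: eq_bigr => i _.
rewrite (mulrnAr y) raddfMn /= -[- (u *: y)]scaleNr exprZn -!scalerAr scalarZ.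
have binE : 'C(m.+1, i.+1)%:R * i.+1%:R = m.+1%:R * 'C(m, i)%:R :> C.
  by rewrite -!natrM mulnC -mul_bin_diag.
rewrite -mulrnAr -[_%:R *+ i.+1]mulr_natr binE -[_ *+ 'C(m, i)]mulr_natr.
by rewrite [in RHS]exprNn (mulrCA y) -exprS exprS; ring.
Qed.

(** Grace's theorem in the form of Walsh's coincidence principle: if a linear
functional vanishes on a product of n factors with parameters in D, then it
vanishes on an n-th power with parameter in D. The factors are replaced one at
a time: fixing the factor x - a y turns L into another functional, which by
Laguerre's theorem still does not vanish on the powers of one degree less.
Both x and y are left free because ('X, 1) parametrizes a polynomial by its
zeros and (1, 'X) by the reciprocals of its zeros, where the parameter 0
stands for a zero at infinity. *)
Theorem Grace D (x y : {poly C}) (L : {scalar {poly C}}) (us : seq C) :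
  polar_separated D -> (forall u, D u -> L ((x - u *: y) ^+ size us) != 0) ->
  (forall u, u \in us -> D u) -> D !=set0 -> L (\prod_(u <- us) (x - u *: y)) != 0.
Proof.
move=> sepD + + [u0 Du0].
elim: us L => [|a us IH] L L0 usD /=; first by rewrite big_nil; apply: L0 Du0.
have Da : D a by apply: usD; rewrite inE eqxx.
rewrite big_cons.
pose M (g : {poly C}) := L ((x - a *: y) * g).
have M_scalar : scalar M by move=> c g h; rewrite /M mulrDr -scalerAr linearP.
pose L' : {scalar {poly C}} := HB.pack M (GRing.isLinear.Build _ _ _ _ M M_scalar).
apply: (IH L') => [u Du|u u_us]; last by apply: usD; rewrite inE u_us orbT.
(* x - a y = (x - u y) + (u - a) y, and the functional applied to
   y (x - u y)^m is the derivative of f, up to the factor -(m + 1). *)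
have [f szf [fE f'E]] := scalar_power_poly L x y (size us).+1.
have f0 v : D v -> f.[v] != 0 by move=> Dv; rewrite fE; apply: L0.
apply: contraNneq (Laguerre sepD szf f0 Da Du) => L'0.
rewrite fE f'E /= mulrN mulrCA -mulrBr mulf_eq0 pnatr_eq0 /= -scalarZ -raddfB.
rewrite -[X in _ == X]L'0 /=; apply/eqP; congr (L _).
by rewrite exprS scalerAl -mulrBl; congr (_ * _); rewrite scalerBl; ring.
Qed.
End Laguerre.

(** * Zeros of Grace-Szego convolutions *)

Section Convolution.
Variable C : numClosedFieldType.
Implicit Types (D E B Y : set C) (P Q : {poly C}) (u v y z c d : C) (n : nat).

Lemma binN0 n k : (k < n.+1)%N -> 'C(n, k)%:R != 0 :> C.
Proof. by rewrite ltnS pnatr_eq0 -lt0n bin_gt0. Qed.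

Lemma GSconvA n P Q (S : {poly C}) :
  GSconv n P (GSconv n Q S) = GSconv n (GSconv n P Q) S.
Proof.
apply/polyP => k; rewrite !coef_poly; case: ifP => // kn.
by rewrite kn !mulrA; congr (_ / _); rewrite mulrAC.
Qed.

Lemma size_GSconv n P Q : (size (GSconv n P Q) <= n.+1)%N.
Proof. exact: size_poly. Qed.

Lemma GSconv_lead n P Q : (GSconv n P Q)`_n = P`_n * Q`_n.
Proof. by rewrite coef_poly ltnSn binn divr1. Qed.

Lemma GSconv_at0 n P Q : (GSconv n P Q).[0] = P.[0] * Q.[0].
Proof. by rewrite !horner_coef0 coef_poly ltnS leq0n bin0 divr1. Qed.

Definition GSconv_at n Q z P := (GSconv n P Q).[z].

Lemma GSconv_at_scalar n Q z : scalar (GSconv_at n Q z).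
Proof.
move=> c P S; rewrite /GSconv_at !horner_poly mulr_sumr -big_split /=.
by apply: eq_bigr => k _; rewrite coefD coefZ; ring.
Qed.

HB.instance Definition _ n Q z := GRing.isLinear.Build C {poly C} C *%R
  (GSconv_at n Q z) (@GSconv_at_scalar n Q z).

Lemma coef_affine_exp n k c d :
  ((c%:P + d *: 'X) ^+ n)`_k = c ^+ (n - k) * d ^+ k * 'C(n, k)%:R.
Proof.
rewrite exprDn.
have -> : \sum_(i < n.+1) c%:P ^+ (n - i) * (d *: 'X) ^+ i *+ 'C(n, i) =
  \poly_(i < n.+1) (c ^+ (n - i) * d ^+ i * 'C(n, i)%:R).
  rewrite poly_def; apply: eq_bigr => i _.
  rewrite exprZn -rmorphXn /= mul_polyC scalerA scalerMnl.
  by rewrite -[_ *+ _]mulr_natr.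
rewrite coef_poly ltnS; case: leqP => // lt_nk.
by rewrite bin_small // mulr0.
Qed.

(** The binomial coefficients of the power cancel those of the convolution; this is
why powers of affine polynomials are the test polynomials. *)
Lemma GSconv_affine_exp n Q c d : (size Q <= n.+1)%N ->
  GSconv n ((c%:P + d *: 'X) ^+ n) Q = \poly_(k < n.+1) (c ^+ (n - k) * d ^+ k * Q`_k).
Proof.
move=> szQ; apply/polyP => k; rewrite !coef_poly; case: ifP => // kn.
by rewrite coef_affine_exp mulrAC mulfK // binN0.
Qed.

Lemma GSconv_1subX_exp n Q y z : (size Q <= n.+1)%N ->
  (GSconv n ((1 - y *: 'X) ^+ n) Q).[z] = Q.[- (y * z)].
Proof.
move=> szQ; rewrite -scaleNr -polyC1 GSconv_affine_exp // horner_poly.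
rewrite (horner_coef_wide _ szQ); apply: eq_bigr => k _.
by rewrite expr1n mul1r -mulNr exprMn; ring.
Qed.

Lemma GSconv_1addX_exp n Q : (size Q <= n.+1)%N -> GSconv n ((1 + 'X) ^+ n) Q = Q.
Proof.
move=> szQ; rewrite -['X]scale1r -polyC1 GSconv_affine_exp //.
apply/polyP => k; rewrite coef_poly !expr1n !mul1r; case: ltnP => // nk.
by rewrite nth_default // (leq_trans szQ).
Qed.

Lemma GSconv_XsubC_exp n Q u v : (size Q <= n.+1)%N ->
  (GSconv n (('X - u%:P) ^+ n) Q).[- (u * v)] = (- u) ^+ n * Q.[v].
Proof.
move=> szQ; rewrite addrC -polyCN -['X]scale1r GSconv_affine_exp // horner_poly.
rewrite (horner_coef_wide _ szQ) mulr_sumr; apply: eq_bigr => k _.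
rewrite expr1n mulr1 -mulNr exprMn.
have -> : (- u) ^+ n = (- u) ^+ (n - k) * (- u) ^+ k.
  by rewrite -exprD subnK // -ltnS.
ring.
Qed.

Lemma pi_eq_XsubC_exp n D u : D u -> pi_eq n D (('X - u%:P) ^+ n).
Proof.
move=> Du; split; first by rewrite size_exp_XsubC.
move=> z; rewrite /root horner_exp hornerXsubC expf_eq0 subr_eq0.
by case/andP=> _ /eqP ->.
Qed.

(** By Grace's theorem a zero z of the convolution of P and Q is also a zero of the
convolution of ('X - u)^n and Q for some u in D, and the zeros of the latter
are the numbers - u v with v a zero of Q. *)
Theorem Szego D n P Q z : polar_separated D -> D !=set0 -> pi_eq n D P ->
  size Q = n.+1 -> root (GSconv n P Q) z ->
  exists u v, [/\ D u, root Q v & z = - (u * v)].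
Proof.
move=> sepD D0 [szP rP] szQ rz; apply: contrapT => no_uv.
pose L : {scalar {poly C}} := GSconv_at n Q z.
have [rs defP] := closed_field_poly_normal P.
have lP : lead_coef P != 0 by rewrite lead_coef_eq0 -size_poly_eq0 szP.
have sz_rs : size rs = n.
  by move: szP; rewrite defP size_scale // size_prod_XsubC => -[].
have szQ' : (size Q <= n.+1)%N by rewrite szQ.
suff: L (\prod_(u <- rs) ('X - u *: 1)) != 0.
  move/negP; apply; rewrite -(mulrI_eq0 _ (mulfI lP)) -scalarZ.
  under eq_bigr do rewrite alg_polyC.
  by rewrite -defP.
apply: Grace sepD _ _ D0; last first.
  move=> u u_rs; apply: rP; rewrite defP rootZ //.
  by rewrite root_prod_XsubC.
move=> u Du; rewrite sz_rs alg_polyC /= /GSconv_at; apply: contra_notN no_uv => /eqP.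
have [u_eq0|u0] := eqVneq u 0; last first.
  have -> : z = - (u * (- z / u)) by field.
  rewrite GSconv_XsubC_exp // => /eqP.
  rewrite mulf_eq0 expf_eq0 oppr_eq0 (negPf u0) andbF /= => rv.
  by exists u, (- z / u).
have Qn : Q`_n != 0.
  by have := lead_coef_eq0 Q; rewrite lead_coefE szQ /= -size_poly_eq0 szQ => ->.
(* For u = 0 the convolution is a monomial, so z = 0, and any zero v of Q will do. *)
rewrite u_eq0 subr0 horner_poly (bigD1 ord_max) //= big1 ?addr0 => [|k /eqP k_n].
  rewrite coefXn eqxx mul1r binn divr1 => /eqP.
  rewrite mulf_eq0 (negPf Qn) /= expf_eq0 => /andP[n0 /eqP ->].
  have /closed_rootP[v rv] : size Q != 1%N by rewrite szQ eqSS -lt0n.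
  by exists u, v; split=> //; rewrite u_eq0 mul0r oppr0.
by rewrite coefXn; case: eqP => [E|]; [case: k_n; apply: val_inj | rewrite !mul0r].
Qed.

Lemma prod_XsubC_inv (rs : seq C) : 0 \notin rs ->
  exists c, \prod_(r <- rs) ('X - r%:P) =
            c *: \prod_(y <- [seq r^-1 | r <- rs]) (1 - y *: 'X).
Proof.
elim: rs => [|r rs IH] /=; first by exists 1; rewrite !big_nil scale1r.
rewrite inE negb_or eq_sym => /andP[r0 /IH[c E]].
have rE : 'X - r%:P = - r *: (1 - r^-1 *: 'X).
  by rewrite scalerBr scalerA mulNr divff // scaleN1r opprK scaleNr alg_polyC addrC.
by exists (- r * c); rewrite !big_cons E rE -scalerAl -scalerAr scalerA.
Qed.

(** The counterpart of Szego's theorem for P of degree at most n. The zeros of P are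
described by their reciprocals, the n - deg P zeros at infinity by 0, so that a
region of the sphere around infinity becomes a disk Y. *)
Theorem Szego_reversed Y n P Q z : polar_separated Y -> Y 0 -> P != 0 ->
  (size P <= n.+1)%N -> (forall x, root P x -> x != 0 /\ Y x^-1) ->
  (size Q <= n.+1)%N -> root (GSconv n P Q) z ->
  exists2 y, Y y & root Q (- (y * z)).
Proof.
move=> sepY Y0 P0 szP rP szQ rz; apply: contrapT => no_y.
pose L : {scalar {poly C}} := GSconv_at n Q z.
have [rs defP] := closed_field_poly_normal P.
have lP : lead_coef P != 0 by rewrite lead_coef_eq0.
have sz_rs : (size rs <= n)%N.
  by move: szP; rewrite defP size_scale // size_prod_XsubC.
have rsP r : r \in rs -> r != 0 /\ Y r^-1.
  by move=> r_rs; apply: rP; rewrite defP rootZ // root_prod_XsubC.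
have [|c prod_rs] := @prod_XsubC_inv rs.
  by apply/negP => /rsP[]; rewrite eqxx.
(* The zeros at infinity are added so that Grace's theorem sees n factors. *)
pose ys := [seq r^-1 | r <- rs] ++ nseq (n - size rs) 0.
have sz_ys : size ys = n by rewrite size_cat size_map size_nseq subnKC.
have defP' : P = (lead_coef P * c) *: \prod_(y <- ys) (1 - y *: 'X).
  rewrite big_cat /= [\prod_(y <- nseq _ _) _]big1_seq => [|y /=].
    by rewrite mulr1 -scalerA -prod_rs -defP.
  by rewrite mem_nseq => /andP[_ /eqP ->]; rewrite scale0r subr0.
suff: L (\prod_(y <- ys) (1 - y *: 'X)) != 0.
  have c0 : lead_coef P * c != 0.
    by apply: contraNneq P0 => c0; rewrite defP' c0 scale0r.
  move/negP; apply; rewrite -(mulrI_eq0 _ (mulfI c0)) -scalarZ.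
  by rewrite -defP'.
apply: Grace sepY _ _ _; last by exists 0.
  move=> y Yy; rewrite sz_ys /= /GSconv_at GSconv_1subX_exp //.
  by apply: contra_notN no_y => ry; exists y.
move=> y; rewrite mem_cat => /orP[/mapP[r /rsP[_ Yr] ->] //|].
by rewrite mem_nseq => /andP[_ /eqP ->].
Qed.

Lemma GSconv_pi_eq D B E n P Q : polar_separated D -> D !=set0 ->
  (forall u v, D u -> B v -> E (- (u * v))) ->
  pi_eq n D P -> pi_eq n B Q -> pi_eq n E (GSconv n P Q).
Proof.
move=> sepD D0 DBE piP [szQ rQ]; have [szP rP] := piP.
split=> [|z /(Szego sepD D0 piP szQ)[u [v [Du rv ->]]]]; last exact: DBE (rQ _ rv).
apply/anti_leq; rewrite size_GSconv /= ltnNge.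
apply/negP => /leq_sizeP /(_ n (leqnn n)) /eqP; rewrite GSconv_lead.
have -> : P`_n = lead_coef P by rewrite lead_coefE szP.
have -> : Q`_n = lead_coef Q by rewrite lead_coefE szQ.
by rewrite mulf_eq0 !lead_coef_eq0 -!size_poly_eq0 szP szQ.
Qed.

Lemma GSconv_pi_le D Y B E n P Q : polar_separated Y -> Y 0 ->
  ~ D 0 -> (forall z, z != 0 -> D z -> Y z^-1) -> ~ B 0 ->
  (forall y z, Y y -> B (- (y * z)) -> E z) ->
  pi_le n D P -> pi_le n B Q -> pi_le n E (GSconv n P Q).
Proof.
move=> sepY Y0 D0 DY B0 YBE [P0 szP rP] [Q0 szQ rQ].
split; last 2 first.
- exact: size_GSconv.
- move=> z rz.
  have [|y Yy ry] := Szego_reversed sepY Y0 P0 szP _ szQ rz; last exact: YBE (rQ _ ry).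
  move=> x /rP Dx; have x0 : x != 0 by apply: contra_notN D0 => /eqP <-.
  by split=> //; apply: DY.
have : (GSconv n P Q).[0] != 0.
  rewrite GSconv_at0 mulf_neq0 //; first by apply: contra_notN D0 => /rP.
  by apply: contra_notN B0 => /rQ.
by apply: contraNneq => ->; rewrite horner0.
Qed.

(** Testing the hypothesis on P = ('X - u)^n, for u in D, confines each zero v of Q:
all the products - u v lie in E. *)
Lemma pi_eq_multiplier D B E n Q : D !=set0 -> (size Q <= n.+1)%N ->
  (forall v, (forall u, D u -> E (- (u * v))) -> B v) ->
  (forall P, pi_eq n D P -> pi_eq n E (GSconv n P Q)) -> pi_eq n B Q.
Proof.
move=> [u0 Du0] szQ BP piQ; split.
  apply/anti_leq; rewrite szQ ltnNge; apply/negP => sz_n.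
  have [sz _] := piQ _ (pi_eq_XsubC_exp n Du0).
  have Qn0 : Q`_n = 0 by apply/leq_sizeP: (leqnn n).
  have /eqP := GSconv_lead n (('X - u0%:P) ^+ n) Q.
  set S := GSconv _ _ _ in sz *.
  have -> : S`_n = lead_coef S by rewrite lead_coefE sz.
  by rewrite Qn0 mulr0 lead_coef_eq0 -size_poly_eq0 sz.
move=> v rv; apply: BP => u Du; have [_] := piQ _ (pi_eq_XsubC_exp n Du); apply.
by rewrite /root GSconv_XsubC_exp // (rootP rv) mulr0.
Qed.

(** The test polynomials are (1 - y 'X)^n; the one with y = 0 is the constant 1 and
shows that Q does not vanish at 0, whence the hypothesis v != 0. *)
Lemma pi_le_multiplier D Y B E n Q : Y 0 -> (size Q <= n.+1)%N ->
  (forall y, Y y -> y != 0 -> D y^-1) ->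
  (forall v, v != 0 -> (forall y, Y y -> y != 0 -> E (- (v / y))) -> B v) ->
  (forall P, pi_le n D P -> pi_le n E (GSconv n P Q)) -> pi_le n B Q.
Proof.
move=> Y0 szQ YD BP piQ.
have test y : Y y -> pi_le n D ((1 - y *: 'X) ^+ n).
  move=> Yy; have p0 : (1 - y *: 'X : {poly C}) != 0.
    apply/eqP => /(congr1 (horner^~ 0)) /eqP.
    by rewrite !hornerE ?(mulr0, subr0) oner_eq0.
  split; first by rewrite expf_neq0.
    rewrite (leq_trans (size_poly_exp_leq _ _)) // ltnS -[leqRHS]mul1n leq_mul2r.
    apply/orP; right; rewrite -subn1 leq_subLR.
    rewrite (leq_trans (size_polyD _ _)) // geq_max size_polyN size_poly1 /=.
    by rewrite (leq_trans (size_scale_leq _ _)) // size_polyX.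
  move=> z; rewrite /root horner_exp expf_eq0 !hornerE subr_eq0 => /andP[_ /eqP yz].
  have y0 : y != 0 by apply: contra_eq_neq yz => ->; rewrite mul0r oner_neq0.
  by have -> : z = y^-1; [rewrite -[LHS](mulKf y0) -yz mulr1 | apply: YD].
have Q00 : Q.[0] != 0.
  have [q0 _ _] := piQ _ (test 0 Y0); move: q0; apply: contraNneq => Q0.
  apply/eqP/polyP => k; rewrite coef0 coef_poly; case: ifP => // _.
  rewrite scale0r subr0 expr1n coef1; case: eqP => [->|_]; last by rewrite !mul0r.
  by rewrite -horner_coef0 Q0 mulr0 mul0r.
split=> //; first by apply: contraNneq Q00 => ->; rewrite horner0.
move=> v rv; apply: BP => [|y Yy y0].
  by apply: contraNneq Q00 => v0; rewrite v0 in rv.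
have [_ _] := piQ _ (test y Yy); apply; rewrite /root GSconv_1subX_exp //.
by have -> : - (y * - (v / y)) = v by field.
Qed.
End Convolution.

(** * The four regions and their closures *)

Lemma closure_normP (C : numFieldType) (S : set C) (z : C) :
  closure S z <-> forall e, 0 < e -> exists2 y, S y & `|z - y| < e.
Proof.
split=> [clS e e0|H B].
  have [y [Sy]] := clS _ (nbhsx_ballx z (PosNum e0)%:num e0).
  by rewrite -ball_normE /=; exists y.
case/nbhs_ballP => e /= e0 eB; have [y Sy zy] := H e e0.
by exists y; split=> //; apply: eB; rewrite -ball_normE.
Qed.

(** The Lipschitz bound puts the closure inside the weak sublevel set; the last
hypothesis, in which z is moved by a small proportion of its norm, gives the
converse. *)
Lemma closure_sublevel (C : numFieldType) (F : C -> C) :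
  (forall z, F z \is Num.real) ->
  (forall z y, F z <= F y + 2 * `|z - y|) ->
  (forall z t, F z <= 0 -> 0 < t -> t < 1 ->
     exists2 y, F y < 0 & `|z - y| <= t * `|z|) ->
  closure [set z | F z < 0] = [set z | F z <= 0].
Proof.
move=> F_real F_lip F_path; apply/seteqP; split=> z /=.
  move/closure_normP => clz; rewrite real_leNgt ?real0 //; apply/negP => Fz.
  have [|y /= Fy zy] := clz (F z / 2); first by rewrite divr_gt0.
  have zy2 : 2 * `|z - y| < F z by rewrite mulrC -ltr_pdivlMr.
  by have := le_lt_trans (F_lip z y) (ltrD Fy zy2); rewrite add0r ltxx.
move=> Fz; apply/closure_normP => e e0.
have M0 : 0 < e + `|z| by rewrite ltr_wpDr.
have [||y Fy zy] := F_path z (e / (2 * (e + `|z|))) Fz.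
- by rewrite divr_gt0 // mulr_gt0.
- rewrite ltr_pdivrMr ?mulr_gt0 // mul1r mulr_natl mulr2n ltr_pwDl //.
  by rewrite lerDl.
exists y => //; apply: le_lt_trans zy _.
rewrite mulrAC ltr_pdivrMr ?mulr_gt0 // ltr_pM2l //.
by rewrite mulr_natl mulr2n ltr_wpDl ?ltW // ltr_pwDl.
Qed.

Section Sets.
Variable C : numClosedFieldType.
Variables tau g : C.
Hypotheses (tau0 : tau != 0) (g_ge0 : 0 <= g) (g_lt1 : g < 1).

Let g_le1 : g <= 1 := ltW g_lt1.
Let g_real : g \is Num.real := ger0_real g_ge0.

(** By convexity along the segment from z to 0, where F is negative, contracting
towards 0 makes a weak inequality strict. *)
Lemma closure_sublevel_convex (F : C -> C) :
  (forall z, F z \is Num.real) ->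
  (forall z y, F z <= F y + 2 * `|z - y|) ->
  (forall z t, 0 < t -> t < 1 -> F ((1 - t) * z) <= (1 - t) * F z + t * F 0) ->
  F 0 < 0 ->
  closure [set z | F z < 0] = [set z | F z <= 0].
Proof.
move=> F_real F_lip F_cvx F0; apply: closure_sublevel => // z t Fz t0 t1.
exists ((1 - t) * z); last first.
  by rewrite (_ : z - _ = t * z); [rewrite normrM gtr0_norm | ring].
apply: le_lt_trans (F_cvx z t t0 t1) _.
by rewrite ltr_wnDl // ?mulr_ge0_le0 ?subr_ge0 ?(ltW t1) // pmulr_rlt0.
Qed.

(** Inequalities between sums of norms follow from one another by comparing the two
differences, which is a ring identity. *)
Lemma ler_eq_sub (a b x y : C) : b - a = y - x -> a <= b -> x <= y.
Proof. by move=> E; rewrite -subr_ge0 E subr_ge0. Qed.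

Lemma norm_lip (k : C) (a b : C) : 0 <= k -> k <= 1 ->
  k * `|a| <= k * `|b| + `|a - b|.
Proof.
move=> k0 k1; rewrite -lerBlDl -mulrBr.
apply: (@le_trans _ _ (k * `|a - b|)).
  by rewrite ler_wpM2l // lerB_dist.
by rewrite ler_piMl.
Qed.

Lemma norm_convex (a b t : C) : 0 < t -> t < 1 ->
  `|(1 - t) * a + t * b| <= (1 - t) * `|a| + t * `|b|.
Proof.
move=> t0 t1; apply: le_trans (ler_normD _ _) _.
by rewrite !normrM (gtr0_norm t0) gtr0_norm // subr_gt0.
Qed.

(** Om_open and Om_closed are the image of the disk and its closure, through the
inequality |z| < 1 (or <= 1) for the preimage z = u / (tau - g u). *)
Definition Om_open : set C := [set u | `|u| < `|tau - g * u|].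
Definition Om_closed : set C := [set u | `|u| <= `|tau - g * u|].
Definition I_closed : set C := [set z | `|z| + g * `|1 + z| <= 1].
Definition O_closed : set C := [set z | 1 <= `|z| - g * `|1 + z|].
(** Y_open and Y_closed are the images under z |-> 1 / z, infinity included, of the
complements of Om_closed and Om_open (see Y_open_inv and Y_closed_inv). *)
Definition Y_open : set C := [set y | `|tau * y - g| < 1].
Definition Y_closed : set C := [set y | `|tau * y - g| <= 1].

Lemma OmegaE : Omega tau g = Om_open.
Proof.
apply/seteqP; rewrite /Om_open; split=> [_ [z + <-]|u]; rewrite /w /=.
  rewrite /unit_disk /= => z1.
  have d0 : 1 + g * z != 0.
    rewrite addr_eq0; apply: contraTneq z1 => E.
    have gz : 1 = g * `|z| by rewrite -[LHS]normr1 E normrN normrM ger0_norm.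
    by rewrite -real_leNgt ?normr_real // gz ler_piMl.
  have -> : tau - g * (tau * z / (1 + g * z)) = tau / (1 + g * z) by field.
  rewrite mulrAC normrM gtr_pMr // normr_gt0 mulf_neq0 //.
  by rewrite invr_neq0.
move=> u_lt.
have d0 : tau - g * u != 0 by rewrite -normr_gt0 (le_lt_trans _ u_lt).
exists (u / (tau - g * u)).
  by rewrite /unit_disk /= normrM normfV ltr_pdivrMr ?mul1r ?normr_gt0.
rewrite /w; have -> : 1 + g * (u / (tau - g * u)) = tau / (tau - g * u) by field.
by field; rewrite tau0 d0.
Qed.

Let g2_gt0 : 0 < 1 - g ^+ 2.
Proof. by rewrite subr_gt0 expr_lt1. Qed.

(** Completing the square: the image of the unit disk is again a disk, with centre
- g tau / (1 - g^2) and radius |tau| / (1 - g^2). *)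
Lemma Om_disk_identity (u : C) :
  `|(1 - g ^+ 2) * u + g * tau| ^+ 2 - `|tau| ^+ 2 =
  (1 - g ^+ 2) * (`|u| ^+ 2 - `|tau - g * u| ^+ 2).
Proof.
have gC : g^* = g := conj_Creal g_real.
rewrite !normCK !(rmorphD, rmorphN, rmorphM, rmorphXn, rmorph1) /= gC; ring.
Qed.

Lemma Om_open_disk : Om_open = [set u | `|(1 - g ^+ 2) * u + g * tau| < `|tau|].
Proof.
apply/seteqP; rewrite /Om_open; split=> u /=;
  rewrite -[_ < `|tau|](@ltr_pXn2r _ 2) ?nnegrE //
    -[`|u| < _](@ltr_pXn2r _ 2) ?nnegrE //;
  by rewrite -subr_lt0 -[X in _ -> is_true X]subr_lt0 Om_disk_identity pmulr_rlt0.
Qed.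

Lemma Om_closed_disk : Om_closed = [set u | `|(1 - g ^+ 2) * u + g * tau| <= `|tau|].
Proof.
apply/seteqP; rewrite /Om_closed; split=> u /=;
  rewrite -[_ <= `|tau|](@ler_pXn2r _ 2) ?nnegrE //
    -[`|u| <= _](@ler_pXn2r _ 2) ?nnegrE //;
  by rewrite -subr_le0 -[X in _ -> is_true X]subr_le0 Om_disk_identity pmulr_rle0.
Qed.

Lemma closure_Omega : closure (Omega tau g) = Om_closed.
Proof.
rewrite OmegaE Om_open_disk Om_closed_disk.
pose F u := `|(1 - g ^+ 2) * u + g * tau| - `|tau|.
have -> : [set u | `|(1 - g ^+ 2) * u + g * tau| < `|tau|] = [set u | F u < 0].
  by apply/seteqP; split=> u /=; rewrite subr_lt0.
have -> : [set u | `|(1 - g ^+ 2) * u + g * tau| <= `|tau|] = [set u | F u <= 0].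
  by apply/seteqP; split=> u /=; rewrite subr_le0.
apply: closure_sublevel_convex => [z|z y|z t t0 t1|].
- by rewrite rpredB ?normr_real.
- rewrite /F addrAC lerD2r.
  have := @norm_lip 1 ((1 - g ^+ 2) * z + g * tau)
    ((1 - g ^+ 2) * y + g * tau) ler01 (lexx _).
  rewrite !mul1r => /le_trans; apply; rewrite lerD2l.
  rewrite (_ : _ - _ = (1 - g ^+ 2) * (z - y)); last by ring.
  rewrite normrM ler_wpM2r // gtr0_norm // lerBlDr (le_trans (_ : 1 <= 2)) ?ler1n //.
  by rewrite lerDl exprn_ge0.
- rewrite /F mulr0 add0r.
  have := norm_convex ((1 - g ^+ 2) * z + g * tau) (g * tau) t0 t1.
  rewrite (_ : _ + t * _ = (1 - g ^+ 2) * ((1 - t) * z) + g * tau); last by ring.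
  rewrite normrM (ger0_norm g_ge0); apply: ler_eq_sub; ring.
by rewrite /F mulr0 add0r subr_lt0 normrM ger0_norm // gtr_pMl // normr_gt0.
Qed.

Lemma closure_Iset : closure (Iset g) = I_closed.
Proof.
pose F z := `|z| + g * `|1 + z| - 1.
have -> : Iset g = [set z | F z < 0].
  by apply/seteqP; rewrite /Iset; split=> u /=; rewrite subr_lt0.
have -> : I_closed = [set z | F z <= 0].
  by apply/seteqP; rewrite /I_closed; split=> u /=; rewrite subr_le0.
apply: closure_sublevel_convex => [z|z y|z t t0 t1|].
- by rewrite rpredB ?rpred1 // rpredD ?rpredM ?normr_real.
- have h1 := @norm_lip 1 z y ler01 (lexx _).
  have h2 := @norm_lip g (1 + z) (1 + y) g_ge0 g_le1.
  rewrite (_ : 1 + z - (1 + y) = z - y) in h2; last by ring.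
  by apply: ler_eq_sub (lerD h1 h2); rewrite /F; ring.
- have h1 := norm_convex z 0 t0 t1.
  have h2 := norm_convex (1 + z) 1 t0 t1.
  rewrite !mulr0 addr0 normr0 mulr0 addr0 in h1.
  rewrite (_ : (1 - t) * (1 + z) + t * 1 = 1 + (1 - t) * z) in h2; last by ring.
  apply: ler_eq_sub (lerD h1 (ler_wpM2l g_ge0 h2)).
  by rewrite /F normr0 addr0 normr1; ring.
by rewrite /F normr0 addr0 normr1 mulr1 add0r subr_lt0.
Qed.

(** The function |z| - g |1 + z| need not be convex, but moving away from 0 increases
|z| faster than g |1 + z|, since g < 1. *)
Lemma closure_Oset : closure (Oset g) = O_closed.
Proof.
pose F z := 1 - (`|z| - g * `|1 + z|).
have -> : Oset g = [set z | F z < 0].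
  by apply/seteqP; rewrite /Oset; split=> u /=; rewrite subr_lt0.
have -> : O_closed = [set z | F z <= 0].
  by apply/seteqP; rewrite /O_closed; split=> u /=; rewrite subr_le0.
apply: closure_sublevel => [z|z y|z t Fz t0 t1].
- by rewrite rpredB ?rpred1 // rpredB ?rpredM ?normr_real.
- have h1 := @norm_lip 1 y z ler01 (lexx _).
  have h2 := @norm_lip g (1 + z) (1 + y) g_ge0 g_le1.
  rewrite distrC in h1.
  rewrite (_ : 1 + z - (1 + y) = z - y) in h2; last by ring.
  by apply: ler_eq_sub (lerD h1 h2); rewrite /F; ring.
have z0 : z != 0.
  apply: contraTneq Fz => ->; rewrite /F normr0 addr0 normr1 mulr1 add0r opprK.
  by rewrite -real_ltNge ?real0 ?realD ?real1 // ltr_wpDr.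
exists ((1 + t) * z); last first.
  rewrite (_ : z - _ = - (t * z)); last by ring.
  by rewrite normrN normrM gtr0_norm.
have h : g * `|1 + (1 + t) * z| <= g * (`|1 + z| + t * `|z|).
  rewrite ler_wpM2l // (_ : 1 + (1 + t) * z = (1 + z) + t * z); last by ring.
  by rewrite (le_trans (ler_normD _ _)) // normrM gtr0_norm.
have t1_0 : 0 < 1 + t by rewrite addr_gt0.
rewrite /F [`|(1 + t) * z|]normrM (gtr0_norm t1_0).
apply: (@le_lt_trans _ _ (F z + (g - 1) * (t * `|z|))).
  by apply: ler_eq_sub h; rewrite /F; ring.
by rewrite ltr_wnDl // nmulr_rlt0 ?subr_lt0 // mulr_gt0 // normr_gt0.
Qed.
End Sets.

(** * Products of points of the regions, and the multiplier theorems *)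

Section Multipliers.
Variable C : numClosedFieldType.
Variables tau g : C.
Hypotheses (tau0 : tau != 0) (g_ge0 : 0 <= g) (g_lt1 : g < 1).
Let g_real : g \is Num.real := ger0_real g_ge0.

Local Notation Op := (Om_open tau g).
Local Notation Cl := (Om_closed tau g).

(** Triangle inequality for tau + g u v = (tau - g u) + g u (1 + v). The two terms of
the left-hand side are the defects of u in Om and of v in I. *)
Lemma product_bound_I (u v : C) :
  (`|tau - g * u| - `|u|) + `|u| * (1 - (`|v| + g * `|1 + v|)) <=
  `|tau - g * - (u * v)| - `|- (u * v)|.
Proof.
have h := lerB_normD (tau - g * u) (g * (u * (1 + v))).
rewrite (_ : _ + g * (u * _) = tau - g * - (u * v)) in h; last by ring.
rewrite !(normrM g) normrM (ger0_norm g_ge0) in h.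
rewrite normrN (normrM u); apply: ler_eq_sub h; ring.
Qed.

(** Triangle inequality for y (tau - g z) = (tau y - g) + g (1 + v) with v = - y z. The
two terms of the left-hand side are the defects of y in Y and of v in O. *)
Lemma product_bound_O (y z : C) :
  (1 - `|tau * y - g|) + ((`|- (y * z)| - g * `|1 + - (y * z)|) - 1) <=
  `|y| * (`|z| - `|tau - g * z|).
Proof.
have h := ler_normD (tau * y - g) (g * (1 + - (y * z))).
rewrite (_ : _ + g * (1 + _) = y * (tau - g * z)) in h; last by ring.
rewrite normrM (normrM g) (ger0_norm g_ge0) in h.
by rewrite normrN normrM; apply: ler_eq_sub h; ring.
Qed.

(** Strictness in one factor is enough, the product with u = 0 being 0. *)
Lemma Om_open_product (u v : C) :
  (`|u| <= `|tau - g * u|) -> `|v| + g * `|1 + v| <= 1 ->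
  [|| u == 0, `|u| < `|tau - g * u| | `|v| + g * `|1 + v| < 1] -> Op (- (u * v)).
Proof.
move=> u_le v_le; rewrite /Om_open /=.
have [-> _|u0 /= strict] := eqVneq u 0.
  by rewrite mul0r oppr0 mulr0 subr0 normr0 normr_gt0.
rewrite -subr_gt0; apply: lt_le_trans (product_bound_I u v).
case/orP: strict => lt.
  by rewrite ltr_pwDl ?subr_gt0 // mulr_ge0 // subr_ge0.
by rewrite ltr_wpDl ?subr_ge0 // mulr_gt0 ?subr_gt0 ?normr_gt0.
Qed.

Lemma Om_closed_Iset_product (u v : C) : Cl u -> Iset g v -> Op (- (u * v)).
Proof.
move=> u_le v_lt; apply: Om_open_product => //; first exact: ltW.
by rewrite [X in _ || (_ || X)]v_lt !orbT.
Qed.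

Lemma Om_open_I_closed_product (u v : C) : Op u -> I_closed g v -> Op (- (u * v)).
Proof.
move=> u_lt v_le; apply: Om_open_product => //; first exact: ltW.
by rewrite [X in _ || (X || _)]u_lt !orbT.
Qed.

Lemma Om_closed_I_closed_product (u v : C) : Cl u -> I_closed g v -> Cl (- (u * v)).
Proof.
move=> u_le v_le; rewrite /Om_closed /= -subr_ge0.
apply: le_trans (product_bound_I u v).
by rewrite addr_ge0 ?mulr_ge0 ?subr_ge0.
Qed.

Lemma O_closed_neq0 (v : C) : O_closed g v -> v != 0.
Proof.
rewrite /O_closed /=; apply: contraTneq => ->.
rewrite normr0 addr0 normr1 mulr1 sub0r -real_ltNge ?realN ?real1 //.
by rewrite (@le_lt_trans _ _ 0) ?oppr_le0.
Qed.

Lemma notin_Om_closed_product (y z : C) : Y_closed tau g y -> O_closed g (- (y * z)) ->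
  (`|tau * y - g| < 1) || (1 < `|- (y * z)| - g * `|1 + - (y * z)|) ->
  (~` Cl) z.
Proof.
move=> y_le v_ge strict; rewrite /Om_closed /=; apply/negP.
rewrite -real_ltNge ?normr_real //.
have y0 : 0 < `|y|.
  by have := O_closed_neq0 v_ge; rewrite normr_gt0 oppr_eq0 mulf_eq0 negb_or => /andP[].
rewrite -subr_gt0 -(pmulr_rgt0 _ y0); apply: lt_le_trans (product_bound_O y z).
case/orP: strict => lt.
  by rewrite ltr_pwDl ?subr_gt0 // subr_ge0.
by rewrite ltr_wpDl ?subr_ge0 // subr_gt0.
Qed.

Lemma Y_closed_Oset_product (y z : C) :
  Y_closed tau g y -> Oset g (- (y * z)) -> (~` Cl) z.
Proof.
move=> y_le v_gt; apply: (@notin_Om_closed_product y) => //; first exact: ltW.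
by rewrite [X in _ || X]v_gt orbT.
Qed.

Lemma Y_open_O_closed_product (y z : C) :
  Y_open tau g y -> O_closed g (- (y * z)) -> (~` Cl) z.
Proof.
move=> y_lt v_ge; apply: (@notin_Om_closed_product y) => //; first exact: ltW.
by rewrite [X in X || _]y_lt.
Qed.

Lemma Y_closed_O_closed_product (y z : C) :
  Y_closed tau g y -> O_closed g (- (y * z)) -> (~` Op) z.
Proof.
move=> y_le v_ge; rewrite /Om_open /=; apply/negP; rewrite -real_leNgt ?normr_real //.
have y0 : 0 < `|y|.
  by have := O_closed_neq0 v_ge; rewrite normr_gt0 oppr_eq0 mulf_eq0 negb_or => /andP[].
rewrite -subr_ge0 -(pmulr_rge0 _ y0); apply: le_trans (product_bound_O y z).
by rewrite addr_ge0 // subr_ge0.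
Qed.

Lemma phase (x : C) : exists2 e : C, `|e| = 1 & x = e * `|x|.
Proof.
have [->|x0] := eqVneq x 0; first by exists 1; rewrite ?normr1 ?normr0 ?mulr0.
have nx0 : `|x| != 0 by rewrite normr_eq0.
by exists (x / `|x|); rewrite ?divfK // normrM normfV normr_id divff.
Qed.

(** If v is not in I, equality holds in the triangle inequality for the u chosen so
that g u (1 + v) and tau - g u are oppositely directed; u is scaled so that
- u v lands on the boundary circle of Om. *)
Lemma extremal_factor_I (v : C) : 1 <= `|v| + g * `|1 + v| ->
  exists u, [/\ u != 0, `|tau - g * u| = (`|v| + g * `|1 + v|) * `|u|
              & ~ Op (- (u * v))].
Proof.
set S := `|v| + _ => S1; have [e e1 eE] := phase (1 + v).
have S0 : 0 < S by apply: lt_le_trans S1.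
have d0 : S * e - g != 0.
  rewrite subr_eq0; apply: contraTneq S1 => /(congr1 (fun x => `|x|)).
  rewrite normrM e1 mulr1 (gtr0_norm S0) (ger0_norm g_ge0) => ->.
  by rewrite -real_ltNge ?real1.
exists (- tau / (S * e - g)); split.
- by rewrite mulf_neq0 ?oppr_eq0 ?invr_eq0.
- rewrite (_ : tau - _ = S * (e * tau / (S * e - g))); last by field.
  by rewrite normrM (gtr0_norm S0) !normrM e1 mul1r normrN.
rewrite /Om_open /=; set u := - tau / _.
have -> : tau - g * - (u * v) = tau * (S * e - g * (1 + v)) / (S * e - g).
  by rewrite /u; field.
rewrite [X in g * X]eE (_ : S * e - _ = e * `|v|); last by rewrite /S; ring.
by rewrite /u normrN !normrM e1 mul1r normr_id normrN mulrAC ltxx.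
Qed.

Lemma Iset_of_products (v : C) : (forall u, Cl u -> Op (- (u * v))) -> Iset g v.
Proof.
move=> H; rewrite /Iset /= real_ltNge ?realD ?realM ?normr_real //.
apply/negP => S1; have [u [u0 uE]] := extremal_factor_I S1.
by apply; apply: H; rewrite /Om_closed /= uE ler_peMl.
Qed.

Lemma I_closed_of_products (v : C) : (forall u, Op u -> Op (- (u * v))) -> I_closed g v.
Proof.
move=> H; rewrite /I_closed /= real_leNgt ?realD ?realM ?normr_real //.
apply/negP => S1; have [u [u0 uE]] := extremal_factor_I (ltW S1).
by apply; apply: H; rewrite /Om_open /= uE ltr_pMl // normr_gt0.
Qed.

(** The unit number e makes tau y - g and g (1 + v) parallel, and S is chosen so that
|tau y + g v| = |v|, which says that - v / y is on the boundary circle of Om. *)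
Lemma extremal_factor_O (v : C) : v != 0 ->
  exists y, [/\ y != 0, `|tau * y - g| = `| `|v| - g * `|1 + v| |
              & Cl (- (v / y))].
Proof.
move=> v0; have [e e1 eE] := phase (1 + v).
set S := `|v| - _; pose y := (g + e * S) / tau.
have tauyE : tau * y = g + e * S by rewrite /y mulrC divfK.
have tauyv : tau * y + g * v = e * `|v|.
  by rewrite tauyE (_ : _ + g * v = g * (1 + v) + e * S);
    [rewrite [X in g * X]eE /S|]; ring.
have y0 : y != 0.
  apply: contra_neq v0 => y0; move: tauyv; rewrite y0 mulr0 add0r.
  move/(congr1 (fun x => `|x|)); rewrite !normrM normr_id e1 (ger0_norm g_ge0) => /eqP.
  by rewrite -subr_eq0 -mulrBl mulf_eq0 subr_eq0 (lt_eqF g_lt1) normr_eq0 => /eqP.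
exists y; split=> //.
  by rewrite tauyE addrC addKr normrM e1 mul1r.
rewrite /Om_closed /= (_ : tau - _ = (tau * y + g * v) / y); last by field.
by rewrite tauyv normrN !normrM normr_id e1 mul1r.
Qed.

(** With extremal_factor_O, this turns an upper bound by 1 for |v| - g |1 + v| into
one for its absolute value, as membership of y in Y requires. *)
Lemma O_defect_gtN1 (v : C) : -1 < `|v| - g * `|1 + v|.
Proof.
have h : g * `|1 + v| <= g * (1 + `|v|).
  by rewrite ler_wpM2l // (le_trans (ler_normD _ _)) // normr1.
apply: (@lt_le_trans _ _ ((1 - g) * `|v| - g)).
  by rewrite ltr_wpDl ?mulr_ge0 ?subr_ge0 ?(ltW g_lt1) // ltrN2.
by apply: ler_eq_sub h; ring.
Qed.

Let S_real (v : C) : `|v| - g * `|1 + v| \is Num.real.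
Proof. by rewrite rpredB ?rpredM ?normr_real. Qed.

Lemma Oset_of_quotients (v : C) : v != 0 ->
  (forall y, Y_closed tau g y -> y != 0 -> (~` Cl) (- (v / y))) -> Oset g v.
Proof.
move=> v0 H; rewrite /Oset /= real_ltNge ?real1 //.
apply/negP => S1; have [y [y0 yE Cy]] := extremal_factor_O v0.
apply: (H y _ y0 Cy); rewrite /Y_closed /= yE real_ler_norml // S1 andbT.
exact: ltW (O_defect_gtN1 v).
Qed.

Lemma O_closed_of_quotients (v : C) : v != 0 ->
  (forall y, Y_open tau g y -> y != 0 -> (~` Cl) (- (v / y))) -> O_closed g v.
Proof.
move=> v0 H; rewrite /O_closed /= real_leNgt ?real1 //.
apply/negP => S1; have [y [y0 yE Cy]] := extremal_factor_O v0.
apply: (H y _ y0 Cy); rewrite /Y_open /= yE real_ltr_norml // S1 andbT.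
exact: O_defect_gtN1 v.
Qed.

Lemma norm_Y_inv (z : C) : z != 0 -> `|tau * z^-1 - g| = `|tau - g * z| / `|z|.
Proof. by move=> z0; rewrite -normf_div; congr `|_|; field. Qed.

Lemma Y_closed_inv (z : C) : z != 0 -> Y_closed tau g z^-1 <-> (~` Op) z.
Proof.
move=> z0; rewrite /Y_closed /= norm_Y_inv // ler_pdivrMr ?normr_gt0 // mul1r.
by rewrite real_leNgt ?normr_real //; split=> /negP.
Qed.

Lemma Y_open_inv (z : C) : z != 0 -> Y_open tau g z^-1 <-> (~` Cl) z.
Proof.
move=> z0; rewrite /Y_open /= norm_Y_inv // ltr_pdivrMr ?normr_gt0 // mul1r.
by rewrite real_ltNge ?normr_real //; split=> /negP.
Qed.

Lemma Om_open_separated : polar_separated Op.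
Proof.
apply: (@affine_disk_polar_separated _ Op (1 - g ^+ 2) (g * tau) `|tau|) => //.
  by rewrite gt_eqF // subr_gt0 expr_lt1.
by left; apply: Om_open_disk.
Qed.

Lemma Om_closed_separated : polar_separated Cl.
Proof.
apply: (@affine_disk_polar_separated _ Cl (1 - g ^+ 2) (g * tau) `|tau|) => //.
  by rewrite gt_eqF // subr_gt0 expr_lt1.
by right; apply: Om_closed_disk.
Qed.

Lemma Y_open_separated : polar_separated (Y_open tau g).
Proof. by apply: (affine_disk_polar_separated tau0 ler01); left. Qed.

Lemma Y_closed_separated : polar_separated (Y_closed tau g).
Proof. by apply: (affine_disk_polar_separated tau0 ler01); right. Qed.

Lemma Om_open0 : Op 0.
Proof. by rewrite /Om_open /= mulr0 subr0 normr0 normr_gt0. Qed.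
Lemma Om_closed0 : Cl 0.
Proof. exact: ltW Om_open0. Qed.
Lemma Y_open0 : Y_open tau g 0.
Proof. by rewrite /Y_open /= mulr0 sub0r normrN ger0_norm. Qed.
Lemma Y_closed0 : Y_closed tau g 0.
Proof. exact: ltW Y_open0. Qed.

Variable n : nat.
Implicit Types P Q : {poly C}.

Lemma I_closed_preserves_Om_closed P Q :
  pi_eq n Cl P -> pi_eq n (I_closed g) Q -> pi_eq n Cl (GSconv n P Q).
Proof.
apply: GSconv_pi_eq Om_closed_separated _ Om_closed_I_closed_product.
by exists 0; apply: Om_closed0.
Qed.

Lemma O_closed_preserves_nOm_open P Q :
  pi_le n (~` Op) P -> pi_le n (O_closed g) Q -> pi_le n (~` Op) (GSconv n P Q).
Proof.
apply: GSconv_pi_le Y_closed_separated Y_closed0 _ _ _ Y_closed_O_closed_product.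
- by move/(_ Om_open0).
- by move=> z z0 /(Y_closed_inv z0).
by move/O_closed_neq0; rewrite eqxx.
Qed.

Lemma Iset_multiplierP Q : (size Q <= n.+1)%N ->
  (forall P, pi_eq n Cl P -> pi_eq n Op (GSconv n P Q)) <-> pi_eq n (Iset g) Q.
Proof.
move=> szQ; split.
  by apply: pi_eq_multiplier szQ Iset_of_products; exists 0; apply: Om_closed0.
move=> piQ P piP.
apply: GSconv_pi_eq Om_closed_separated _ Om_closed_Iset_product piP piQ.
by exists 0; apply: Om_closed0.
Qed.

Lemma I_closed_multiplierP Q : (size Q <= n.+1)%N ->
  (forall P, pi_eq n Op P -> pi_eq n Op (GSconv n P Q)) <-> pi_eq n (I_closed g) Q.
Proof.
move=> szQ; split.
  by apply: pi_eq_multiplier szQ I_closed_of_products; exists 0; apply: Om_open0.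
move=> piQ P piP.
apply: GSconv_pi_eq Om_open_separated _ Om_open_I_closed_product piP piQ.
by exists 0; apply: Om_open0.
Qed.

Lemma Oset_multiplierP Q : (size Q <= n.+1)%N ->
  (forall P, pi_le n (~` Op) P -> pi_le n (~` Cl) (GSconv n P Q))
    <-> pi_le n (Oset g) Q.
Proof.
move=> szQ; split.
  apply: pi_le_multiplier Y_closed0 szQ _ Oset_of_quotients => y Yy y0.
  by apply/Y_closed_inv; rewrite ?invr_eq0 ?invrK.
move=> piQ P piP.
apply: GSconv_pi_le Y_closed_separated Y_closed0 _ _ _ Y_closed_Oset_product
  piP piQ.
- by move/(_ Om_open0).
- by move=> z z0 /(Y_closed_inv z0).
by move/ltW/O_closed_neq0; rewrite eqxx.
Qed.

Lemma O_closed_multiplierP Q : (size Q <= n.+1)%N ->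
  (forall P, pi_le n (~` Cl) P -> pi_le n (~` Cl) (GSconv n P Q))
    <-> pi_le n (O_closed g) Q.
Proof.
move=> szQ; split.
  apply: pi_le_multiplier Y_open0 szQ _ O_closed_of_quotients => y Yy y0.
  by apply/Y_open_inv; rewrite ?invr_eq0 ?invrK.
move=> piQ P piP.
apply: GSconv_pi_le Y_open_separated Y_open0 _ _ _ Y_open_O_closed_product
  piP piQ.
- by move/(_ Om_closed0).
- by move=> z z0 /(Y_open_inv z0).
by move/O_closed_neq0; rewrite eqxx.
Qed.

Lemma pi_eqW (D : set C) P : pi_eq n D P -> pi_le n D P.
Proof. by case=> szP rP; split=> //; rewrite ?szP // -size_poly_eq0 szP. Qed.

Lemma pi_eq_unit (D : set C) : D (-1) -> pi_eq n D ((1 + 'X) ^+ n).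
Proof.
by move=> D1; have := pi_eq_XsubC_exp n D1; rewrite polyCN opprK polyC1 addrC.
Qed.

(** I is the multiplier region of Om, so the claim for P * Q follows from the claims
for P and for Q by associativity of the convolution. Conversely (1 + 'X)^n is
the unit of the convolution, and its zero -1 lies on the boundary of I. *)
Lemma Iset_absorbP Q : (size Q <= n.+1)%N ->
  (forall P, pi_eq n (I_closed g) P -> pi_eq n (Iset g) (GSconv n P Q))
    <-> pi_eq n (Iset g) Q.
Proof.
move=> szQ; split=> [absQ|piQ P piP].
  rewrite -(GSconv_1addX_exp szQ); apply/absQ/pi_eq_unit.
  by rewrite /I_closed /= normrN1 subrr normr0 mulr0 addr0.
apply/Iset_multiplierP => [|P' piP']; first exact: size_GSconv.
rewrite GSconvA; have [_ /(_ piQ)] := Iset_multiplierP szQ; apply.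
exact: I_closed_preserves_Om_closed.
Qed.

(** Same argument as for Iset_absorbP; -1 also lies on the boundary of O. *)
Lemma Oset_absorbP Q : (size Q <= n.+1)%N ->
  (forall P, pi_le n (O_closed g) P -> pi_le n (Oset g) (GSconv n P Q))
    <-> pi_le n (Oset g) Q.
Proof.
move=> szQ; split=> [absQ|piQ P piP].
  rewrite -(GSconv_1addX_exp szQ); apply/absQ/pi_eqW/pi_eq_unit.
  by rewrite /O_closed /= normrN1 subrr normr0 mulr0 subr0.
apply/Oset_multiplierP => [|P' piP']; first exact: size_GSconv.
rewrite GSconvA; have [_ /(_ piQ)] := Oset_multiplierP szQ; apply.
exact: O_closed_preserves_nOm_open.
Qed.
End Multipliers.

Local Open Scope complex_scope.
Theorem theorem20 (R : realType) (n : nat) (tau : R[i]) (gamma : R)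
    (Q : {poly R[i]}) (tau_neq0 : tau != 0) (gamma_ge0 : 0 <= gamma)
    (gamma_lt1 : gamma < 1) (degQ : (size Q <= n.+1)%N) :
  let Om : set R[i] := Omega tau gamma%:C in
  let clOm : set R[i] := closure (Omega tau gamma%:C) in
  let Ig : set R[i] := Iset gamma%:C in
  let clI : set R[i] := closure (Iset gamma%:C) in
  let Og : set R[i] := Oset gamma%:C in
  let clO : set R[i] := closure (Oset gamma%:C) in
  [/\ (forall P : {poly R[i]}, pi_eq n clOm P ->
         pi_eq n Om (GSconv n P Q))
        <-> pi_eq n Ig Q,
      (forall P : {poly R[i]}, pi_eq n Om P ->
         pi_eq n Om (GSconv n P Q))
        <-> pi_eq n clI Q,
      (forall P : {poly R[i]}, pi_le n (~` Om) P ->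
         pi_le n (~` clOm) (GSconv n P Q))
        <-> pi_le n Og Q &
  [/\ (forall P : {poly R[i]}, pi_le n (~` clOm) P ->
         pi_le n (~` clOm) (GSconv n P Q))
        <-> pi_le n clO Q,
      (forall P : {poly R[i]}, pi_eq n clI P ->
         pi_eq n Ig (GSconv n P Q))
        <-> pi_eq n Ig Q &
      (forall P : {poly R[i]}, pi_le n clO P ->
         pi_le n Og (GSconv n P Q))
        <-> pi_le n Og Q]].
Proof.
move=> Om clOm Ig clI Og clO.
have g0 : 0 <= gamma%:C :> R[i] by rewrite (lecR 0 gamma).
have g1 : gamma%:C < 1 :> R[i] by rewrite (ltcR gamma 1).
have -> : Om = Om_open tau gamma%:C := OmegaE tau_neq0 g0 g1.
have -> : clOm = Om_closed tau gamma%:C := closure_Omega tau_neq0 g0 g1.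
have -> : clI = I_closed gamma%:C := closure_Iset g0 g1.
have -> : clO = O_closed gamma%:C := closure_Oset g0 g1.
split; [exact: Iset_multiplierP | exact: I_closed_multiplierP
       | exact: Oset_multiplierP |].
split; first exact: O_closed_multiplierP.
  exact: (Iset_absorbP tau_neq0 g0 g1).
exact: (Oset_absorbP tau_neq0 g0 g1).
Qed.
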